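(* Let $N(t)$, $t\ge0$, be a homogeneous Poisson process of rate $\lambda>0$. For every fixed $t>0$, $$\int_0^t N(s)\,\mathrm ds\ \overset{\mathrm d}{=}\ \sum_{j=1}^{N(t)}X_j ,$$ where $X_1,X_2,\dots$ are i.i.d. random variables uniformly distributed on $[0,t]$ and independent of $N(t)$, and the sum on the right-hand side is equal to zero when $N(t)=0$.
   Context: The symbol $\overset{\mathrm d}{=}$ denotes equality in distribution of the two random variables, for the fixed time $t$. *)

(* Defs.v *)
From HB Require Import structures.
From mathcomp Require Import all_boot all_order all_algebra.
From mathcomp Require Import all_classical all_reals all_analysis.

Set Implicit Arguments.
Unset Strict Implicit.
Unset Printing Implicit Defensive.

Import Order.TTheory GRing.Theory Num.Theory.
Import numFieldNormedType.Exports.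

Local Open Scope classical_set_scope.
Local Open Scope ring_scope.

Section independence.
Context (d : measure_display) (T : measurableType d) (R : realType).
Context (P : probability T R).
Context (d' : measure_display) (T' : measurableType d').

Definition mutually_independent (I : eqType) (X : I -> T -> T') : Prop :=
  forall (J : seq I) (A : I -> set T'), uniq J ->
    (forall i, i \in J -> measurable (A i)) ->
    P (\bigcap_(i in [set` J]) X i @^-1` A i) =
    (\prod_(i <- J) P (X i @^-1` A i))%E.

Definition sigma_generated (I : Type) (X : I -> T -> T') : set (set T) :=
  <<s [set E | exists i, exists2 B, measurable B & E = X i @^-1` B] >>.

Definition independent_classes (F G : set (set T)) : Prop :=
  forall E H, F E -> G H -> P (E `&` H) = (P E * P H)%E.

End independence.

Section equality_in_distribution.
Context (d : measure_display) (T : measurableType d) (R : realType).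
Context (P : probability T R).

(* The laws are compared on measurable sets only: [pushforward] is also
   defined on the other sets, where its value carries no information. *)
Definition eq_in_distribution (Y Z : T -> R) : Prop :=
  [/\ measurable_fun setT Y, measurable_fun setT Z &
      forall A : set R, measurable A -> pushforward P Y A = pushforward P Z A].

End equality_in_distribution.

Section processes.
Context (d : measure_display) (T : measurableType d) (R : realType).
Context (P : probability T R).

(* Time is indexed by all of [R], but only times [>= 0] are constrained.
   Since paths are nondecreasing, the truncated subtraction of [nat] gives
   the true increments over [s <= t].
   The law is required for [s < t] only: [poisson_pmf 0 k] is [1] for all [k],
   so it is not the degenerate law at [0]. *)
Record poisson_process (lambda : R) (N : R -> {RV P >-> nat}) : Prop := {
  poisson_process_start : forall w, N 0 w = 0%N ;
  poisson_process_ndecr : forall w (s t : R),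
    0 <= s -> s <= t -> (N s w <= N t w)%N ;
  poisson_process_rcont : forall w (t : R),
    0 <= t -> N s w @[s --> t^'+] --> N t w ;
  poisson_process_indep : forall (n : nat) (u : nat -> R),
    0 <= u 0%N -> (forall i, (i < n)%N -> u i <= u i.+1) ->
    mutually_independent P
      (fun (i : 'I_n) (w : T) => (N (u i.+1) w - N (u i) w)%N) ;
  poisson_process_law : forall (s t : R) (k : nat),
    0 <= s -> s < t ->
    P [set w | (N t w - N s w)%N = k] = (poisson_pmf (lambda * (t - s)) k)%:E
}.

Definition iid_uniform (t : R) (t_gt0 : 0 < t) (X : nat -> {RV P >-> R}) : Prop :=
  mutually_independent P (fun j => X j : T -> R) /\
  forall j (A : set R), measurable A ->
    distribution P (X j) A = uniform_prob t_gt0 A.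

(* Independence of the whole sequence [X] from [Y], not just of each [X j]. *)
Definition independent_of (X : nat -> {RV P >-> R}) (Y : {RV P >-> nat}) : Prop :=
  independent_classes P
    (sigma_generated (fun j => X j : T -> R))
    (sigma_generated (fun _ : unit => Y : T -> nat)).

End processes.

(* Main.v *)
Require Import Defs.
From HB Require Import structures.
From mathcomp Require Import all_boot all_order all_algebra.
From mathcomp Require Import all_classical all_reals all_analysis.
From mathcomp Require Import measurable_realfun ring lra.

Set Implicit Arguments.
Unset Strict Implicit.
Unset Printing Implicit Defensive.

Import Order.TTheory GRing.Theory Num.Theory.
Import numFieldNormedType.Exports.

Local Open Scope classical_set_scope.
Local Open Scope ring_scope.

(** Cut [0, t] into n cells of length h = t / n. The upper Riemann sum of the
integral is h * \sum_(i < n) N ((i + 1) h), and summation by parts writes it as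
\sum_(k < n) h (n - k) * Delta_k, where the increments Delta_k of N over the
cells are independent Poisson variables of rate lambda h. On the other side,
round every X_j up to a multiple of h. Up to a null event, the rounded sum is
\sum_(k < n) h (n - k) * C_k, where C_k counts the j < N t such that X_j lies in
](n - k - 1) h, (n - k) h]. By Poisson splitting the counts C_k are again
independent Poisson variables of rate lambda h, so the two discretised variables
have the same law exactly, for every n
([eq_in_distribution_discretised]).

Poisson splitting is proved on atoms: conditioning on N t = m, each of the
words of length m that say in which cell each X_j lies has probability n ^- m,
the number of words with prescribed letter counts c is m! / \prod_k c_k!
([card_words]), and the product of these two numbers with the Poisson weight of m
is the product of the Poisson weights of the c_k ([poisson_pmf_multinomial]).

For n = 2 ^ m both discretised variables decrease as m grows, the first to
the integral because N is nondecreasing, and the second to the sum of the X_j.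
If Y_m decreases to Y then the event Y < a is the increasing union of the events
Y_m < a, so equality of the laws passes to the limit
([eq_in_distribution_nonincreasing]). *)

(** * Equality of laws: atoms and monotone limits *)

Section laws.
Context (d : measure_display) (T : measurableType d) (R : realType).
Context (P : probability T R).

(** A countable index type has no canonical order, so both unions are sliced
along [pickle] to reach the sequences for which sigma-additivity is stated. *)
Lemma eq_measure_countable_bigcup (C : countType) (D : set C) (E F : C -> set T) :
    (forall c, measurable (E c)) -> (forall c, measurable (F c)) ->
    trivIset setT E -> trivIset setT F -> (forall c, P (E c) = P (F c)) ->
  P (\bigcup_(c in D) E c) = P (\bigcup_(c in D) F c).
Proof.
pose slice (G : C -> set T) n := \bigcup_(c in [set c | D c /\ pickle c = n]) G c.
have slice_pickle G c : D c -> slice G (pickle c) = G c.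
  move=> Dc; apply/seteqP; split=> [w [c' [_ /(pcan_inj pickleK)->]]//|w Gcw].
  by exists c.
have slice0 G n : (forall c, D c -> pickle c <> n) -> slice G n = set0.
  by move=> Dn; apply/seteqP; split=> // w [c [/Dn]].
have sliceP n : (exists2 c, D c & pickle c = n) \/ forall c, D c -> pickle c <> n.
  have [|Dn] := pselect (exists2 c, D c & pickle c = n); [by left|right].
  by move=> c Dc cn; apply: Dn; exists c.
have bigcup_slice G : \bigcup_(c in D) G c = \bigcup_n slice G n.
  apply/seteqP; split=> w [c]; first by move=> Dc Gc; exists (pickle c) => //; exists c.
  by move=> _ [c' [Dc' _] Gc']; exists c'.
have mslice G n : (forall c, measurable (G c)) -> measurable (slice G n).
  move=> mG; case: (sliceP n) => [[c Dc <-]|/slice0->//].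
  by rewrite slice_pickle.
have tslice G : trivIset setT G -> trivIset setT (slice G).
  move=> tG i j _ _ [w [[c [_ ci] Gc] [c' [_ cj] Gc']]].
  by rewrite -ci -cj (tG c c' I I)//; exists w.
move=> mE mF tE tF PEF.
have PE G : (forall c, measurable (G c)) -> trivIset setT G ->
    P (\bigcup_(c in D) G c) = (\sum_(n <oo) P (slice G n))%E.
  move=> mG tG; rewrite bigcup_slice; apply: measure_semi_bigcup.
  - by move=> n; exact: mslice.
  - exact: tslice.
  - by apply: bigcupT_measurable => n; exact: mslice.
rewrite !PE//; apply: eq_eseriesr => n _; case: (sliceP n) => [[c Dc <-]|Dn].
  by rewrite !slice_pickle.
by rewrite !slice0.
Qed.

Lemma preimage_comp_bigcup (C : Type) (V : T -> C) (g : C -> R) (A : set R) :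
  (g \o V) @^-1` A = \bigcup_(c in g @^-1` A) V @^-1` [set c].
Proof.
apply/seteqP; split=> [w gVw|w [c gc]]; first by exists (V w).
by rewrite /preimage/= => ->.
Qed.

Lemma countable_measurable_fun (C : countType) (V : T -> C) (g : C -> R) :
  (forall c, measurable (V @^-1` [set c])) -> measurable_fun setT (g \o V).
Proof.
move=> mV _ A mA; rewrite setTI preimage_comp_bigcup bigcup_mkcond.
apply: countable_bigcupT_measurable => //= c.
by case: ifP.
Qed.

(** The events [F c] need not cover the space: they have the same probabilities
as the fibers of [V], whose sum is 1, so what they miss is a null event and [W]
is free there. The inclusion of the union of the [F c] with [g c \in A] in
[W @^-1` A] gives one inequality between the laws; applied to the complement
of [A], it gives the other. *)
Lemma eq_in_distribution_atoms (C : countType) (V : T -> C) (F : C -> set T)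
    (g : C -> R) (W : T -> R) :
    (forall c, measurable (V @^-1` [set c])) ->
    (forall c, measurable (F c)) -> trivIset setT F ->
    (forall c, P (V @^-1` [set c]) = P (F c)) ->
    (forall c w, F c w -> W w = g c) ->
    measurable_fun setT W ->
  eq_in_distribution P (g \o V) W.
Proof.
move=> mV mF tF PVF Wg mW; have mgV := countable_measurable_fun g mV.
have mpre (f : T -> R) A : measurable_fun setT f -> measurable A ->
    measurable (f @^-1` A).
  by move=> mf mA; rewrite -[_ @^-1` _]setTI; exact: mf.
split=> //.
have le A : measurable A -> (pushforward P (g \o V) A <= pushforward P W A)%E.
  move=> mA; rewrite /pushforward preimage_comp_bigcup.
  rewrite (@eq_measure_countable_bigcup _ _ _ F)//.
    apply: le_measure; rewrite ?inE.
    - rewrite bigcup_mkcond; apply: countable_bigcupT_measurable => //= c.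
      by case: ifP.
    - exact: mpre.
    - by move=> w [c Ac /Wg Ww]; rewrite /preimage/= Ww.
  by move=> c c' _ _ [w [<- <-]].
move=> A mA; apply/eqP; rewrite eq_le le//=.
have leC : (P (~` ((g \o V) @^-1` A)) <= P (~` (W @^-1` A)))%E := le _ (measurableC mA).
have [mVA mWA] := (mpre _ _ mgV mA, mpre _ _ mW mA).
move: leC; rewrite !probability_setC// /pushforward.
by rewrite -[P (_ @^-1` A)]fineK ?fin_num_measure// -[P (W @^-1` A)]fineK
  ?fin_num_measure// -!EFinB !lee_fin lerD2l lerN2.
Qed.

(** The open rays ]-oo, a[ are stable under intersection and generate the Borel
sets. *)
Lemma eq_in_distribution_lt (Y Z : T -> R) :
    measurable_fun setT Y -> measurable_fun setT Z ->
    (forall a, P [set w | Y w < a] = P [set w | Z w < a]) ->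
  eq_in_distribution P Y Z.
Proof.
move=> mY mZ YZ; split=> // A mA.
pose Y' : {mfun T >-> R} := HB.pack Y (isMeasurableFun.Build _ _ _ _ _ mY).
pose Z' : {mfun T >-> R} := HB.pack Z (isMeasurableFun.Build _ _ _ _ _ mZ).
rewrite -[LHS]/(distribution P Y' A) -[RHS]/(distribution P Z' A).
refine (@measure_unique _ R _ (@RGenInftyO.G R) (fun n => `]-oo, n%:R[%classic)
  _ _ _ _ (distribution P Y') (distribution P Z') _ _ A mA).
- exact: RGenInftyO.measurableE.
- move=> _ _ [x ->] [y ->]; exists (Num.min x y).
  by apply/seteqP; split=> z /=; rewrite !in_itv/= lt_min; [case=> -> ->|case/andP].
- by move=> n; exists n%:R.
- apply/seteqP; split=> // x _; exists (Num.truncn `|x|).+1 => //=.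
  by rewrite in_itv/=; rewrite (le_lt_trans (ler_norm _))// truncnS_gt.
- move=> _ [a ->]; have := YZ a.
  rewrite /distribution /pushforward/=.
  congr (P _ = P _); apply/seteqP; split=> w /=; by rewrite /preimage/= in_itv.
- by move=> n; rewrite ltey_eq fin_num_measure.
Qed.

Lemma bigcup_lt_nonincreasing_cvg (Y_ : nat -> T -> R) (Y : T -> R) a :
    (forall w, nonincreasing_seq (Y_ ^~ w)) ->
    (forall w, Y_ m w @[m --> \oo] --> Y w) ->
  [set w | Y w < a] = \bigcup_m [set w | Y_ m w < a].
Proof.
move=> nY cY; apply/seteqP; split=> w /=; last first.
  move=> [m _ /= Ya]; apply: le_lt_trans Ya.
  have <- := cvg_lim (@Rhausdorff R) (cY w).
  by apply: nonincreasing_cvgn_ge => //; apply/cvg_ex; exists (Y w).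
move=> Ya; have [m _ /(_ m (leqnn m))] := cvgr_lt _ (cY w) _ Ya.
by exists m.
Qed.

(** Monotonicity makes the events [Y_ m w < a] increase with [m], so that their
probabilities converge to that of their union for every [a], including the
atoms of the limit law. *)
Lemma eq_in_distribution_nonincreasing (Y_ Z_ : nat -> T -> R) (Y Z : T -> R) :
    (forall m, eq_in_distribution P (Y_ m) (Z_ m)) ->
    (forall w, nonincreasing_seq (Y_ ^~ w)) ->
    (forall w, Y_ m w @[m --> \oo] --> Y w) ->
    (forall w, nonincreasing_seq (Z_ ^~ w)) ->
    (forall w, Z_ m w @[m --> \oo] --> Z w) ->
  eq_in_distribution P Y Z.
Proof.
move=> YZ nY cY nZ cZ.
have mlt (U : T -> R) a : measurable_fun setT U -> measurable [set w | U w < a].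
  move=> mU; have := mU measurableT `]-oo, a[%classic (measurable_itv _).
  by rewrite setTI; congr measurable; apply/seteqP; split=> w /=;
    rewrite /preimage/= in_itv.
have ndlt (U : nat -> T -> R) a : (forall w, nonincreasing_seq (U ^~ w)) ->
    nondecreasing_seq (fun m => [set w | U m w < a]).
  move=> nU m n mn; apply/subsetPset => w /=; apply: le_lt_trans; exact: nU.
apply: eq_in_distribution_lt.
- by apply: (measurable_fun_cvg (h := Y_)) => [m|w _]; [have [] := YZ m|].
- by apply: (measurable_fun_cvg (h := Z_)) => [m|w _]; [have [] := YZ m|].
move=> a; rewrite (bigcup_lt_nonincreasing_cvg a nY cY).
rewrite (bigcup_lt_nonincreasing_cvg a nZ cZ).
have mYa m : measurable [set w | Y_ m w < a] by apply: mlt; have [] := YZ m.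
have mZa m : measurable [set w | Z_ m w < a] by apply: mlt; have [] := YZ m.
have := nondecreasing_cvg_mu (mu := P) mYa (bigcupT_measurable _ mYa) (ndlt _ a nY).
have := nondecreasing_cvg_mu (mu := P) mZa (bigcupT_measurable _ mZa) (ndlt _ a nZ).
have -> : P \o (fun m => [set w | Y_ m w < a]) = P \o (fun m => [set w | Z_ m w < a]).
  apply/funext => m /=; have [_ _] := YZ m.
  move=> /(_ `]-oo, a[%classic (measurable_itv _)); rewrite /pushforward.
  congr (P _ = P _); apply/seteqP; split=> w /=; by rewrite /preimage/= in_itv.
by move=> cvZ cvY; exact: cvg_unique cvY cvZ.
Qed.

End laws.

(** * Words with prescribed letter counts *)

Definition letter_counts (n : nat) (s : seq 'I_n) : {ffun 'I_n -> nat} :=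
  [ffun k => count_mem k s].

Lemma sum_letter_counts (V : nmodType) (n : nat) (s : seq 'I_n) (a : 'I_n -> V) :
  \sum_(j <- s) a j = \sum_k a k *+ letter_counts s k.
Proof.
elim: s => [|x s IH].
  by rewrite big_nil big1// => k _; rewrite ffunE mulr0n.
rewrite big_cons IH (bigD1 x)//= [in RHS](bigD1 x)//= !ffunE/= eqxx mulrS addrA.
congr (_ + _); apply: eq_bigr => k kx; rewrite !ffunE/= eq_sym (negbTE kx).
by rewrite add0n.
Qed.

(** The multinomial coefficient, by induction on the length: removing the first
letter [k] of a word lowers the count of [k] by one and divides the product of
factorials by [c k], and the [c k] add up to the length. *)
Lemma card_words (n m : nat) (c : {ffun 'I_n -> nat}) :
  (\sum_k c k = m ->
  #|[pred s : m.-tuple 'I_n | letter_counts s == c]| * \prod_k (c k)`! = m`!)%N.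
Proof.
elim: m c => [|m IH] c cm.
  have c0 k : c k = 0%N.
    by apply/eqP; rewrite -leqn0 -cm (bigD1 k)//= leq_addr.
  rewrite big1 ?muln1 => [|k _]; last by rewrite c0.
  rewrite (eq_card (B := predT)) ?card_tuple ?expn0// => s.
  rewrite !inE (tuple0 s); apply/eqP/ffunP => k.
  by rewrite ffunE/= c0.
pose minus k : {ffun 'I_n -> nat} := [ffun i => (c i - (i == k))%N].
have split_words : #|[pred s : m.+1.-tuple 'I_n | letter_counts s == c]| =
    (\sum_(k | 0 < c k) #|[pred s : m.-tuple 'I_n | letter_counts s == minus k]|)%N.
  rewrite -sum1_card.
  rewrite (partition_big (fun s : m.+1.-tuple 'I_n => thead s)
    (fun k => 0 < c k)%N)/=; last first.
    move=> s; rewrite inE => /eqP <-; rewrite ffunE; case/tupleP: s => x s.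
    by rewrite theadE/= eqxx.
  apply: eq_bigr => k ck.
  rewrite -sum1_card (reindex (fun s : m.-tuple 'I_n => cons_tuple k s))/=; last first.
    exists (fun s : m.+1.-tuple 'I_n => [tuple of behead s]) => s.
      by move=> _; apply/val_inj.
    rewrite inE => /andP[_ /eqP <-].
    by rewrite [RHS]tuple_eta; apply/val_inj.
  apply: eq_bigl => s; rewrite !inE theadE eqxx andbT.
  apply/eqP/eqP => /ffunP sc; apply/ffunP => i; have := sc i;
    rewrite !ffunE /= [k == i]eq_sym; case: eqP => [->|_] /=.
  - by move=> <-; rewrite add1n subn1.
  - by move=> <-; rewrite add0n subn0.
  - by move=> ->; rewrite subn1 add1n prednK.
  - by move=> ->; rewrite add0n subn0.
rewrite split_words big_distrl/= (eq_bigr (fun k => c k * m`!)%N) => [|k ck].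
  rewrite -big_distrl/= factS; congr (_ * _)%N.
  rewrite -cm [RHS](bigID (fun k => 0 < c k)%N)/= [X in (_ + X)%N]big1 ?addn0// => k.
  by rewrite -eqn0Ngt => /eqP.
rewrite -(IH (minus k)); last first.
  apply/succn_inj; rewrite -cm (bigD1 k)//= [in RHS](bigD1 k)//= ffunE eqxx subn1.
  rewrite -addSn prednK//; congr (_ + _)%N.
  by apply: eq_bigr => i /negbTE ik; rewrite ffunE ik subn0.
rewrite mulnCA; congr (_ * _)%N.
rewrite [in LHS](bigD1 k)//= [in RHS](bigD1 k)//= ffunE eqxx subn1 mulnA.
rewrite -[in LHS](prednK ck) factS (prednK ck); congr (_ * _)%N.
by apply: eq_bigr => i /negbTE ik; rewrite ffunE ik subn0.
Qed.

(** * Riemann sums of nondecreasing functions *)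

(** Summation by parts: the increment over the [i]-th step is counted once in
each of the [n - i] values [a i.+1, ..., a n]. *)
Lemma sum_increments (a : nat -> nat) (n : nat) :
    a 0%N = 0%N -> {homo a : i j / (i <= j)%N} ->
  (\sum_(i < n) a i.+1 = \sum_(i < n) (n - i) * (a i.+1 - a i))%N.
Proof.
move=> a0 nda; elim: n => [|n IH]; first by rewrite !big_ord0.
have tele : (\sum_(i < n.+1) (a i.+1 - a i) = a n.+1)%N.
  by rewrite -(big_mkord xpredT (fun i => a i.+1 - a i)%N) telescope_sumn ?a0 ?subn0.
rewrite [LHS]big_ord_recr/= IH -{1}tele.
rewrite [in RHS](eq_bigr (fun i : 'I_n.+1 =>
  (n - i) * (a i.+1 - a i) + (a i.+1 - a i))%N); last first.
  by move=> i _; rewrite subSn -1?ltnS// mulSn addnC.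
by rewrite big_split/= [in RHS]big_ord_recr/= subnn mul0n addn0.
Qed.

Lemma sum_even_odd (V : nmodType) (g : nat -> V) (n : nat) :
  \sum_(i < n.*2) g i = \sum_(i < n) (g i.*2 + g i.*2.+1).
Proof.
elim: n => [|n IH]; first by rewrite !big_ord0.
by rewrite doubleS !big_ord_recr/= IH addrA.
Qed.

Lemma dyadic_bound_cvg (R : realType) (u : nat -> R) (l C : R) :
  (forall m, l <= u m <= l + C / 2 ^+ m) -> u m @[m --> \oo] --> l.
Proof.
move=> lu; apply: (@squeeze_cvgr _ _ _ _ (fun=> l) (fun m => l + C / 2 ^+ m)).
- by apply: nearW.
- exact: cvg_cst.
rewrite -[X in _ --> X]addr0; apply: cvgD; first exact: cvg_cst.
rewrite -(mulr0 C); apply: cvgMr.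
under eq_fun do rewrite -exprVn.
by apply: cvg_expr; rewrite ger0_norm ?invr_ge0// invf_lt1 ?ltr1n.
Qed.

Section riemann.
Context (R : realType) (f : R -> R).
Hypothesis ndf : {homo f : x y / x <= y}.
Local Notation mu := (@lebesgue_measure R).

Lemma nondecreasing_integrable (a b : R) : mu.-integrable `[a, b] (EFin \o f).
Proof.
apply: measurable_bounded_integrable => //.
- by rewrite /= lebesgue_measure_itv/=; case: ifPn => // _; rewrite -EFinB ltry.
- exact: nondecreasing_measurable.
exists (`|f a| + `|f b|); split; rewrite ?num_real// => M abM x /=.
rewrite in_itv/= => /andP[ax xb].
have := ndf ax; have := ndf xb => fxb fax.
rewrite ler_norml; have := ler_norm (f b); have := ler_norm (- f a).
rewrite normrN; have := normr_ge0 (f a); have := normr_ge0 (f b).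
by move=> *; apply/andP; split; lra.
Qed.

Lemma nondecreasing_Rintegral_bounds (a b : R) : a <= b ->
  (b - a) * f a <= \int[mu]_(x in `[a, b]) f x <= (b - a) * f b.
Proof.
move=> ab.
have itab := nondecreasing_integrable a b.
have icst r : mu.-integrable `[a, b] (EFin \o fun=> r).
  apply: measurable_bounded_integrable => //.
  - by rewrite /= lebesgue_measure_itv/=; case: ifPn => // _; rewrite -EFinB ltry.
  - exact: bounded_cst.
have int_cst r : (b - a) * r = \int[mu]_(x in `[a, b]) r.
  rewrite Rintegral_cst// mulrC /= lebesgue_measure_itv/= lte_fin.
  case: ltP => //= ba; have -> : a = b by apply/eqP; rewrite eq_le ab.
  by rewrite subrr.
rewrite !int_cst; apply/andP; split; apply: le_Rintegral => //= x;
  by rewrite in_itv/= => /andP[ax xb]; exact: ndf.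
Qed.

Lemma nondecreasing_Rintegral_split (a b c : R) : a <= b -> b <= c ->
  \int[mu]_(x in `[a, c]) f x =
  \int[mu]_(x in `[a, b]) f x + \int[mu]_(x in `[b, c]) f x.
Proof.
move=> ab bc.
have := Rintegral_itvB (nondecreasing_integrable a c) (x := b).
rewrite !bnd_simp => /(_ ab bc) intB.
rewrite -[in RHS](@Rintegral_itv_obnd_cbnd _ b (BRight c)).
  by rewrite -intB addrC subrK.
apply: integrableS (nondecreasing_integrable b c) => //.
exact: subset_itv_oc_cc.
Qed.

Lemma nondecreasing_Riemann_sum_bounds (h : R) (n : nat) : 0 <= h ->
  h * \sum_(i < n) f (i%:R * h) <= \int[mu]_(x in `[0, n%:R * h]) f x
    <= h * \sum_(i < n) f (i.+1%:R * h).
Proof.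
move=> h0; elim: n => [|n IH].
  by rewrite !big_ord0 mul0r mulr0 set_itv1 Rintegral_set1 lexx.
rewrite (@nondecreasing_Rintegral_split _ (n%:R * h)); last 2 first.
- by rewrite mulr_ge0.
- by rewrite ler_wpM2r// ler_nat.
rewrite !big_ord_recr/= !mulrDr.
have : n%:R * h <= n.+1%:R * h by rewrite ler_wpM2r// ler_nat.
move=> /nondecreasing_Rintegral_bounds.
have -> : n.+1%:R * h - n%:R * h = h by rewrite -natr1; ring.
by move: IH => /andP[? ?] /andP[? ?]; rewrite !lerD.
Qed.

(** The upper and the lower sums differ by a telescoping sum, so the error is at
most the variation of [f] times the step. *)
Lemma upper_Riemann_sum_bounds (t : R) (n : nat) : 0 <= t -> (0 < n)%N ->
  \int[mu]_(x in `[0, t]) f x <= t / n%:R * \sum_(i < n) f (i.+1%:R * (t / n%:R))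
    <= \int[mu]_(x in `[0, t]) f x + t * (f t - f 0) / n%:R.
Proof.
move=> t0 n0; have nE : n%:R * (t / n%:R) = t.
  by rewrite mulrCA mulfV ?mulr1// pnatr_eq0 -lt0n.
have := @nondecreasing_Riemann_sum_bounds (t / n%:R) n (divr_ge0 t0 (ler0n _ _)).
rewrite nE => /andP[lo ->]/=.
suff <- : \sum_(i < n) (f (i.+1%:R * (t / n%:R)) - f (i%:R * (t / n%:R))) = f t - f 0.
  rewrite sumrB [t * (_ - _) / _]mulrAC mulrBr.
  by rewrite addrCA lerDl subr_ge0.
rewrite -(big_mkord xpredT (fun i => f (i.+1%:R * (t / n%:R)) - f (i%:R * (t / n%:R)))).
by rewrite telescope_sumr//= nE mul0r.
Qed.

(** Halving the step replaces twice the value at the right end of a cell by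
the values at its middle and at its right end. *)
Lemma upper_dyadic_sum_nonincreasing (t : R) : 0 <= t ->
  nonincreasing_seq (fun m =>
    t / (2 ^ m)%:R * \sum_(i < 2 ^ m) f (i.+1%:R * (t / (2 ^ m)%:R))).
Proof.
move=> t0; apply/nonincreasing_seqP => m.
have -> : (2 ^ m.+1 = (2 ^ m).*2)%N by rewrite expnS mul2n.
have [n n0] : {n | (0 < n)%N & n = (2 ^ m)%N} by exists (2 ^ m)%N; rewrite ?expn_gt0.
move=> <-.
have n0R : 0 < n%:R :> R by rewrite ltr0n.
have hE : t / n.*2%:R = t / n%:R / 2.
  by rewrite -mul2n natrM; field; rewrite gt_eqF.
rewrite hE; set h := t / n%:R; have h0 : 0 <= h by rewrite divr_ge0// ltW.
clearbody h.
rewrite (sum_even_odd (fun i => f (i.+1%:R * (h / 2)))) -mulrA ler_wpM2l//.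
rewrite mulrC ler_pdivrMr// mulr_suml; apply: ler_sum => i _.
rewrite mulr_natr [leRHS]mulr2n; apply: lerD; apply: ndf.
  rewrite -[i.*2.+1%:R]natr1 -[i.+1%:R]natr1 -mul2n natrM; lra.
by rewrite -doubleS -mul2n natrM; lra.
Qed.

End riemann.

(** * Poisson weights *)

Lemma prod_poisson_pmf (R : realType) (n : nat) (c : {ffun 'I_n -> nat}) (r : R) :
    0 < r ->
  \prod_k poisson_pmf r (c k) =
  r ^+ (\sum_k c k) * (\prod_k (c k)`!)%:R^-1 * expR (- (n%:R * r)).
Proof.
move=> r0; rewrite /poisson_pmf r0 !big_split/=.
congr (_ * _ * _).
- by rewrite expr_sum.
- by rewrite natr_prod prodfV.
- by rewrite prodr_const card_ord -mulrN expRM_natl.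
Qed.

(** Poisson splitting at the level of weights: a Poisson number [m] of items,
each put in one of [n] equally likely boxes, gives box counts [c] with the
probabilities of [n] independent Poisson variables of rate [r / n]. *)
Lemma poisson_pmf_multinomial (R : realType) (n : nat)
    (c : {ffun 'I_n -> nat}) (r : R) :
    0 < r -> (0 < n)%N ->
  let m := (\sum_k c k)%N in
  (poisson_pmf r m * n%:R^-1 ^+ m)
    *+ #|[pred s : m.-tuple 'I_n | letter_counts s == c]| =
  \prod_k poisson_pmf (r / n%:R) (c k).
Proof.
move=> r0 n0 m; have n0R : 0 < n%:R :> R by rewrite ltr0n.
rewrite prod_poisson_pmf ?divr_gt0// /poisson_pmf r0 -/m.
rewrite [n%:R * _]mulrCA mulfV ?gt_eqF// mulr1 exprMn.
rewrite -(card_words (erefl m)) natrM -mulr_natr.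
set W := #|_|; set F := (\prod_k _)%N.
have W0 : W%:R != 0 :> R.
  have := fact_gt0 m; rewrite -(card_words (erefl m)) -/W -/F muln_gt0 => /andP[W0 _].
  by rewrite pnatr_eq0 -lt0n.
have F0 : F%:R != 0 :> R by rewrite pnatr_eq0 -lt0n prodn_gt0// => k; rewrite fact_gt0.
by field; rewrite W0 F0.
Qed.

(** * Increments of the Poisson process over a regular grid *)

Section poisson_increments.
Context (R : realType) (d : measure_display) (T : measurableType d).
Context (P : probability T R) (lambda : R) (N : R -> {RV P >-> nat}).
Hypothesis N_poisson : poisson_process lambda N.
Context (h : R) (h_gt0 : 0 < h) (n : nat).

Definition increments (w : T) : {ffun 'I_n -> nat} :=
  [ffun k : 'I_n => N (k.+1%:R * h) w - N (k%:R * h) w]%N.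

Lemma increments_preimage (c : {ffun 'I_n -> nat}) :
  increments @^-1` [set c] = \bigcap_(k in [set` index_enum 'I_n])
    (fun w => N (k.+1%:R * h) w - N (k%:R * h) w)%N @^-1` [set c k].
Proof.
apply/seteqP; split=> w /=; first by move=> <- k _; rewrite /increments/= ffunE.
by move=> wc; apply/ffunP => k; rewrite ffunE; apply: wc; rewrite /= mem_index_enum.
Qed.

Lemma increments_law (c : {ffun 'I_n -> nat}) :
  P (increments @^-1` [set c]) = (\prod_k poisson_pmf (lambda * h) (c k))%:E.
Proof.
rewrite increments_preimage.
have u0 : 0 <= 0%:R * h by rewrite mul0r.
have und i : (i < n)%N -> i%:R * h <= i.+1%:R * h.
  by move=> _; rewrite ler_wpM2r ?ler_nat// ltW.
have := poisson_process_indep N_poisson u0 und.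
move=> /(_ (index_enum 'I_n) (fun k => [set c k]) (index_enum_uniq _)) ->//.
rewrite -prodEFin; apply: eq_bigr => k _.
have := @poisson_process_law _ _ _ _ _ _ N_poisson (k%:R * h) (k.+1%:R * h) (c k).
rewrite mulr_ge0 ?ler0n ?(ltW h_gt0)// ltr_pM2r// ltr_nat ltnSn => /(_ erefl erefl).
by rewrite -mulrBl -natrB// subSnn mul1r.
Qed.

Lemma measurable_increments (c : {ffun 'I_n -> nat}) :
  measurable (increments @^-1` [set c]).
Proof.
rewrite increments_preimage; apply: fin_bigcap_measurable => //.
move=> k _; rewrite -[_ @^-1` _]setTI.
have mN s : measurable_fun setT (N s : T -> nat) by [].
have -> : (fun w => N (k.+1%:R * h) w - N (k%:R * h) w)%N @^-1` [set c k] =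
    \bigcup_(i in [set: nat]) \bigcup_(j in [set j | (i - j)%N = c k])
      (N (k.+1%:R * h) @^-1` [set i] `&` N (k%:R * h) @^-1` [set j]).
  apply/seteqP; split=> w /=.
    by move=> <-; exists (N (k.+1%:R * h) w) => //; exists (N (k%:R * h) w).
  by move=> [i _ [j ij [/= -> ->]]].
apply: measurableI => //; apply: bigcup_measurable => i _.
apply: bigcup_measurable => j _; apply: measurableI.
  by rewrite -[_ @^-1` _]setTI; exact: mN.
by rewrite -[_ @^-1` _]setTI; exact: mN.
Qed.

End poisson_increments.

(** * Random sums and the letters they spell *)

Section random_sums.
Context (R : realType) (d : measure_display) (T : measurableType d).
Context (P : probability T R).

(** The number of terms is random, so the preimages are cut along its values. *)
Lemma measurable_random_sum (M : T -> nat) (Y : nat -> T -> R) :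
    measurable_fun setT M -> (forall j, measurable_fun setT (Y j)) ->
  measurable_fun setT (fun w => \sum_(j < M w) Y j w).
Proof.
move=> mM mY _ A mA; rewrite setTI.
have -> : (fun w => \sum_(j < M w) Y j w) @^-1` A =
    \bigcup_m (M @^-1` [set m] `&` (fun w => \sum_(j < m) Y j w) @^-1` A).
  apply/seteqP; split=> w; first by exists (M w).
  by move=> [m _ [/= <-]].
apply: bigcupT_measurable => m; apply: measurableI.
  by rewrite -[_ @^-1` _]setTI; exact: mM.
rewrite -[_ @^-1` _]setTI.
by apply: (measurable_sum (index_enum 'I_m) (h := fun j : 'I_m => Y j)).
Qed.

Context (X : nat -> {RV P >-> R}) (M : {RV P >-> nat}).
Context (n : nat) (B : 'I_n -> set R).

(** The sets [B k] are the letters of an alphabet, in which the first [M] terms of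
[X] spell a word. *)
Definition word_event (m : nat) (s : m.-tuple 'I_n) : set T :=
  [set w | M w = m /\ forall j : 'I_m, B (tnth s j) (X j w)].

Lemma word_event_inj (m m' : nat) (s : m.-tuple 'I_n) (s' : m'.-tuple 'I_n) w :
    (forall k k' x, B k x -> B k' x -> k = k') ->
  word_event s w -> word_event s' w -> s = s' :> seq 'I_n.
Proof.
move=> B_inj [Mm ws] [Mm' ws'].
case: m / Mm s ws => s ws; case: m' / Mm' s' ws' => s' ws'.
suff -> : s = s' by []; apply: eq_from_tnth => j; exact: B_inj (ws j) (ws' j).
Qed.

(** Prolonging a word by [setT] beyond its length presents its event as an
intersection over indices in [nat], the form in which the independence of the
sequence [X] is stated. *)
Definition letters (m : nat) (s : m.-tuple 'I_n) (j : nat) : set R :=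
  if insub j is Some i then B (tnth s i) else setT.

Lemma word_eventE (m : nat) (s : m.-tuple 'I_n) :
  word_event s =
  (\bigcap_(j in [set` index_iota 0 m]) X j @^-1` letters s j) `&` M @^-1` [set m].
Proof.
apply/seteqP; split=> w [].
  move=> Mm ws; split=> // j _; rewrite /preimage/= /letters.
  by case: insubP => // i _ <-.
move=> ws Mm; split=> // j; have := ws j.
by rewrite /preimage/= /letters mem_index_iota ltn_ord valK; apply.
Qed.

Hypothesis mB : forall k, measurable (B k).

Lemma measurable_letters (m : nat) (s : m.-tuple 'I_n) j : measurable (letters s j).
Proof. by rewrite /letters; case: insubP. Qed.

Lemma measurable_word_event (m : nat) (s : m.-tuple 'I_n) : measurable (word_event s).
Proof.
rewrite word_eventE; apply: measurableI.
  apply: fin_bigcap_measurable => // j _.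
  rewrite -[_ @^-1` _]setTI; apply: measurable_funPT => //; exact: measurable_letters.
by rewrite -[_ @^-1` _]setTI; apply: measurable_funPT.
Qed.

Hypothesis X_indep : mutually_independent P (fun j => X j : T -> R).
Hypothesis XM_indep : independent_of X M.

Lemma prob_word_event (p : R) (m : nat) (s : m.-tuple 'I_n) :
    (forall j k, P (X j @^-1` B k) = p%:E) ->
  P (word_event s) = (P (M @^-1` [set m]) * (p ^+ m)%:E)%E.
Proof.
move=> Xp; rewrite word_eventE XM_indep.
- rewrite X_indep ?iota_uniq// => [|j _]; last exact: measurable_letters.
  rewrite big_mkord muleC; congr (_ * _)%E.
  rewrite (eq_bigr (fun=> p%:E)) => [|j _].
    by rewrite prodEFin prodr_const card_ord.
  by rewrite /letters valK.
(* Finite intersections stay in the sigma-algebra generated by [X]. *)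
- suff : forall J : seq nat, sigma_generated (fun j => X j : T -> R)
      (\bigcap_(j in [set` J]) X j @^-1` letters s j) by [].
  move=> J; apply: (@fin_bigcap_measurable _ (g_sigma_algebraType
    [set E | exists i, exists2 B, measurable B & E = X i @^-1` B])) => // j _.
  apply: sub_sigma_algebra; exists j; exists (letters s j) => //.
  exact: measurable_letters.
- by apply: sub_sigma_algebra; exists tt; exists [set m].
Qed.

(** The words have the total of the counts as their length, so that every one of
the first [M] terms of [X] lies in some letter: one term outside of all the
[B k] excludes [w] from every [count_event c]. *)
Definition count_event (c : {ffun 'I_n -> nat}) : set T :=
  \bigcup_(s in [set s : (\sum_k c k).-tuple 'I_n | letter_counts s = c])
    word_event s.

Hypothesis B_inj : forall k k' x, B k x -> B k' x -> k = k'.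

Lemma trivIset_count_event : trivIset setT count_event.
Proof.
move=> c c' _ _ [w [[s /= sc ws] [s' /= sc' ws']]].
by rewrite -sc -sc' (word_event_inj B_inj ws ws').
Qed.

Lemma measurable_count_event c : measurable (count_event c).
Proof.
apply: fin_bigcup_measurable; first exact: finite_finset.
move=> s _; exact: measurable_word_event.
Qed.

Lemma prob_count_event (r : R) (c : {ffun 'I_n -> nat}) :
    0 < r -> (0 < n)%N ->
    (forall m, P (M @^-1` [set m]) = (poisson_pmf r m)%:E) ->
    (forall j k, P (X j @^-1` B k) = (n%:R^-1)%:E) ->
  P (count_event c) = (\prod_k poisson_pmf (r / n%:R) (c k))%:E.
Proof.
move=> r0 n0 PM PX; rewrite -poisson_pmf_multinomial// /count_event.
have -> : [set s : (\sum_k c k).-tuple 'I_n | letter_counts s = c] =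
    [set` enum [pred s : (\sum_k c k).-tuple 'I_n | letter_counts s == c]].
  by apply/seteqP; split=> s /=; rewrite mem_enum inE => /eqP.
rewrite measure_fin_bigcup//.
- rewrite -fsbig_seq ?enum_uniq// big_enum/=.
  rewrite (eq_bigr (fun=> (poisson_pmf r (\sum_k c k) * n%:R^-1 ^+ (\sum_k c k))%:E)).
    by rewrite sumEFin sumr_const.
  by move=> s _; rewrite (prob_word_event _ PX) PM EFinM.
- move=> s s' _ _ [w [ws ws']]; apply/val_inj; exact: word_event_inj B_inj ws ws'.
- by move=> s _; exact: measurable_word_event.
Qed.

(** Almost surely every [X j] lies in one of the [B k], because they are disjoint
and of total probability [n * n^-1 = 1]. In the proof this fact is carried by
the total mass of the law of [V], through [eq_in_distribution_atoms]. *)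
Lemma eq_in_distribution_random_sum (r : R) (V : T -> {ffun 'I_n -> nat})
    (D : R -> R) (a : 'I_n -> R) :
    0 < r -> (0 < n)%N ->
    (forall m, P (M @^-1` [set m]) = (poisson_pmf r m)%:E) ->
    (forall j k, P (X j @^-1` B k) = (n%:R^-1)%:E) ->
    (forall c, measurable (V @^-1` [set c])) ->
    (forall c, P (V @^-1` [set c]) = (\prod_k poisson_pmf (r / n%:R) (c k))%:E) ->
    measurable_fun setT D ->
    (forall k x, B k x -> D x = a k) ->
  eq_in_distribution P (fun w => \sum_k a k * (V w k)%:R)
    (fun w => \sum_(j < M w) D (X j w)).
Proof.
move=> r0 n0 PM PX mV PV mD Da.
apply: (@eq_in_distribution_atoms _ _ _ _ _ V count_event
  (fun c : {ffun 'I_n -> nat} => \sum_k a k * (c k)%:R)) => //.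
- exact: measurable_count_event.
- exact: trivIset_count_event.
- by move=> c; rewrite PV (prob_count_event _ r0).
- move=> c w [s /= sc [-> ws]]; rewrite -[in RHS]sc.
  rewrite (eq_bigr (fun j => a (tnth s j))) => [|j _].
    rewrite -(big_tuple _ _ s xpredT a) sum_letter_counts.
    by apply: eq_bigr => k _; rewrite mulr_natr.
  exact: Da.
- by apply: (measurable_random_sum (Y := fun j => D \o X j)) => // j;
    exact: measurableT_comp.
Qed.

End random_sums.

(** * Rounding uniform variables to a grid *)

Definition roundup (R : realType) (h x : R) : R := h * (Num.ceil (x / h))%:~R.

Section roundup.
Context (R : realType) (h : R) (h_gt0 : 0 < h).

Lemma roundup_bounds x : x <= roundup h x <= x + h.
Proof.
have /andP[] := ceil_itv (x / h); rewrite /roundup intrB ltr_pdivlMr// ler_pdivrMr//.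
rewrite mulrBl mul1r [h * _]mulrC => lo hi; apply/andP; split; lra.
Qed.

(** A multiple of [h] is a multiple of [h / 2], so rounding up on the finer grid
cannot give a larger value. *)
Lemma roundup_half x : roundup (h / 2) x <= roundup h x.
Proof.
rewrite /roundup -mulrA ler_wpM2l ?(ltW h_gt0)// ler_pdivrMl//.
have -> : 2 * (Num.ceil (x / h))%:~R = (2 * Num.ceil (x / h))%:~R :> R by rewrite intrM.
rewrite ler_int ceil_le_int intrM invf_div mulrA mulrAC mulrC ler_wpM2l//.
by have /andP[] := ceil_itv (x / h).
Qed.

Lemma measurable_roundup : measurable_fun setT (roundup h).
Proof.
apply: nondecreasing_measurable => // x y xy; rewrite ler_wpM2l ?(ltW h_gt0)//.
by rewrite ler_int le_ceil// ler_wpM2r// invr_ge0 ltW.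
Qed.

Lemma roundup_cell (i : nat) x : i%:R * h < x <= i.+1%:R * h ->
  roundup h x = h * i.+1%:R.
Proof.
move=> ix; rewrite /roundup; congr (_ * _).
suff /eqP -> : Num.ceil (x / h) == i.+1%:Z by [].
by rewrite ceil_eq -addn1 PoszD addrK ltr_pdivlMr// ler_pdivrMr// -PoszD addn1.
Qed.

End roundup.

Lemma uniform_prob_itv (R : realType) (a b : R) (ab : a < b) (x y : R) :
    a <= x -> x <= y -> y <= b ->
  uniform_prob ab `]x, y] = ((y - x) / (b - a))%:E.
Proof.
move=> ax xy yb; rewrite /uniform_prob (eq_integral (fun=> ((b - a)^-1)%:E)).
  rewrite integral_cst//= lebesgue_measure_itv/= lte_fin.
  case: ltP => [_|yx]; first by rewrite -EFinB -EFinM mulrC.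
  have -> : x = y by apply/eqP; rewrite eq_le xy.
  by rewrite mule0 subrr mul0r.
move=> z; rewrite inE/= in_itv/= => /andP[xz zy]; rewrite /uniform_pdf.
by rewrite (le_trans ax (ltW xz)) (le_trans zy yb).
Qed.

(** * The discretised identity and its limit *)

Section discretisation.
Context (R : realType) (d : measure_display) (T : measurableType d).
Context (P : probability T R) (lambda : R) (lambda_gt0 : 0 < lambda).
Context (N : R -> {RV P >-> nat}) (N_poisson : poisson_process lambda N).
Context (t : R) (t_gt0 : 0 < t).
Context (X : nat -> {RV P >-> R}) (X_iid : iid_uniform t_gt0 X).
Context (X_indep : independent_of X (N t)).

Lemma upper_sum_increments (h : R) (n : nat) (w : T) : 0 <= h ->
  h * \sum_(i < n) (N (i.+1%:R * h) w)%:R =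
  \sum_(k < n) (h * (n - k)%:R) * (increments N h n w k)%:R.
Proof.
move=> h0; under [in RHS]eq_bigr do rewrite ffunE -mulrA -natrM.
rewrite -mulr_sumr -!natr_sum; congr (_ * _%:R).
apply: (@sum_increments (fun i => N (i%:R * h) w)) => [|i j ij].
  by rewrite mul0r (poisson_process_start N_poisson).
apply: (poisson_process_ndecr N_poisson); first by rewrite mulr_ge0.
by rewrite ler_wpM2r// ler_nat.
Qed.

(** The weight [h * (n - k)] decreases with [k] in the summation by parts of the
Riemann sum, so the cells of the uniform variables are numbered from the right
end of the interval, [B k] being the points that are rounded up to this weight. *)
Lemma eq_in_distribution_discretised (n : nat) : (0 < n)%N ->
  eq_in_distribution P
    (fun w => t / n%:R * \sum_(i < n) (N (i.+1%:R * (t / n%:R)) w)%:R)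
    (fun w => \sum_(j < N t w) roundup (t / n%:R) (X j w)).
Proof.
move=> n0; set h := t / n%:R.
have n0R : 0 < n%:R :> R by rewrite ltr0n.
have h0 : 0 < h by rewrite divr_gt0.
under [X in eq_in_distribution P X]eq_fun do
  rewrite (upper_sum_increments _ _ (ltW h0)).
pose B (k : 'I_n) : set R := `](n - k.+1)%:R * h, (n - k)%:R * h]%classic.
have nk (k : 'I_n) : (n - k = (n - k.+1).+1)%N by rewrite subnSK.
have BD k x : B k x -> roundup h x = h * (n - k)%:R.
  by rewrite /B/= in_itv/= nk; exact: roundup_cell.
have [X_ind X_unif] := X_iid.
apply: (@eq_in_distribution_random_sum _ _ _ _ X (N t) n B _ _ _ _ (lambda * t)) => //.
- by move=> k; exact: measurable_itv.
- move=> k k' x /BD Dk /BD; rewrite Dk => /(mulfI (lt0r_neq0 h0))/eqP.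
  rewrite eqr_nat => /eqP kk'.
  apply/val_inj/eqP; rewrite -(eqn_add2l (n - k)) subnK ?(ltnW (ltn_ord k))//.
  by rewrite kk' subnK// ltnW.
- by rewrite mulr_gt0.
- move=> m; rewrite -[t in lambda * t]subr0.
  rewrite -(poisson_process_law N_poisson m (lexx 0) t_gt0); congr (P _).
  by apply/seteqP; split=> w /=;
    rewrite /preimage/= (poisson_process_start N_poisson) subn0.
- move=> j k; have := X_unif j (B k) (measurable_itv _).
  rewrite /distribution /pushforward => ->.
  rewrite uniform_prob_itv.
  + by rewrite subr0 nk -mulrBl -natrB// subSnn mul1r /h mulrAC mulfV ?mul1r// gt_eqF.
  + by rewrite mulr_ge0// ltW.
  + by rewrite ler_wpM2r ?(ltW h0)// nk ler_nat.
  + by rewrite /h mulrCA ger_pMr// ler_pdivrMr// mul1r ler_nat leq_subr.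
- by move=> c; exact: measurable_increments.
- by move=> c; rewrite (increments_law N_poisson)// /h mulrA.
- exact: measurable_roundup.
Qed.

End discretisation.

(* X_1, X_2, ... of the informal statement is X 0, X 1, ... here. *)
Theorem theorem4p1 (R : realType) (d : measure_display) (T : measurableType d)
    (P : probability T R) (lambda : R) (lambda_gt0 : 0 < lambda)
    (N : R -> {RV P >-> nat}) (N_poisson : poisson_process lambda N)
    (t : R) (t_gt0 : 0 < t)
    (X : nat -> {RV P >-> R}) (X_iid : iid_uniform t_gt0 X)
    (X_indep : independent_of X (N t)) :
  eq_in_distribution P
    (fun w => \int[lebesgue_measure]_(s in `[0, t]) ((N s w)%:R : R))
    (fun w => \sum_(j < N t w) X j w).
Proof.
(* Truncating the time at 0 makes the paths nondecreasing on all of [R]. *)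
pose f w s : R := (N (Num.max 0 s) w)%:R.
have ndf w : {homo f w : x y / x <= y}.
  move=> x y xy; rewrite ler_nat; apply: (poisson_process_ndecr N_poisson).
    by rewrite le_max lexx.
  by rewrite ge_max !le_max lexx xy orbT.
have fE w s : 0 <= s -> f w s = (N s w)%:R by move=> s0; rewrite /f max_r.
have intE w : \int[lebesgue_measure]_(s in `[0, t]) ((N s w)%:R : R) =
    \int[lebesgue_measure]_(s in `[0, t]) f w s.
  by apply: eq_Rintegral => s; rewrite inE/= in_itv/= => /andP[s0 _]; rewrite fE.
have t0 := ltW t_gt0.
have pow2_gt0 m : (0 < 2 ^ m)%N by rewrite expn_gt0.
have step_gt0 m : 0 < t / (2 ^ m)%:R by rewrite divr_gt0// ltr0n.
have step_half m : t / (2 ^ m.+1)%:R = t / (2 ^ m)%:R / 2.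
  by rewrite expnSr natrM invfM mulrA.
have sumE w m :
    t / (2 ^ m)%:R * \sum_(i < 2 ^ m) (N (i.+1%:R * (t / (2 ^ m)%:R)) w)%:R =
    t / (2 ^ m)%:R * \sum_(i < 2 ^ m) f w (i.+1%:R * (t / (2 ^ m)%:R)).
  by congr (_ * _); apply: eq_bigr => i _; rewrite fE// mulr_ge0// ltW.
apply: (eq_in_distribution_nonincreasing
  (fun m => eq_in_distribution_discretised lambda_gt0 N_poisson X_iid X_indep
    (pow2_gt0 m))).
- move=> w; under eq_fun do rewrite sumE.
  exact: upper_dyadic_sum_nonincreasing.
- move=> w; rewrite intE; apply: (@dyadic_bound_cvg _ _ _ (t * (f w t - f w 0))) => m.
  by rewrite sumE -natrX; exact: upper_Riemann_sum_bounds.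
- move=> w; apply/nonincreasing_seqP => m; apply: ler_sum => j _.
  by rewrite step_half; exact: roundup_half.
- move=> w; apply: (@dyadic_bound_cvg _ _ _ (t * (N t w)%:R)) => m.
  apply/andP; split.
    by apply: ler_sum => j _; have /andP[] := roundup_bounds (step_gt0 m) (X j w).
  have -> : t * (N t w)%:R / 2 ^+ m = \sum_(j < N t w) t / (2 ^ m)%:R.
    by rewrite sumr_const card_ord -natrX mulrAC mulr_natr.
  rewrite -big_split/=; apply: ler_sum => j _.
  by have /andP[] := roundup_bounds (step_gt0 m) (X j w).
Qed.
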